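(* Let $k\ge1$ and $1\le h\le k$ be integers with $h$ dividing $k$, let $c\ge0$, and let $X_1,\dots,X_k$ be mutually independent candidates with $f_h(X_i)\ge c$ for all $i$. Then $$g_h(X_1,\dots,X_k)\ge 2hc\left(1-e^{-1/2}\right)^2.$$
   Context: A candidate is a nonnegative discrete random variable taking finitely many values. $g_h(X_1,\dots,X_k)$ is the expected sum of the $h$ largest values among $X_1,\dots,X_k$. $f_h(X)=\mathbb{E}\big(\max(X^{[1]},\dots,X^{[k/h]})\big)$ where $X^{[1]},\dots,X^{[k/h]}$ are independent copies of $X$. *)

(* Defs.v *)
From HB Require Import structures.
From mathcomp Require Import all_boot all_order all_algebra.
From mathcomp Require Import all_classical all_reals all_analysis.

Set Implicit Arguments.
Unset Strict Implicit.
Unset Printing Implicit Defensive.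

Import Order.TTheory GRing.Theory Num.Theory.
Import numFieldNormedType.Exports.

Local Open Scope classical_set_scope.
Local Open Scope ring_scope.

Definition candidate (d : measure_display) (T : measurableType d)
    (R : realType) (P : probability T R) (X : {RV P >-> R}) : Prop :=
  (forall w, 0 <= X w) /\ finite_set (range X).

Definition mutually_independent (d : measure_display) (T : measurableType d)
    (R : realType) (P : probability T R) (I : finType)
    (X : I -> {RV P >-> R}) : Prop :=
  forall (J : {set I}) (A : I -> set R), (forall i, measurable (A i)) ->
  P (\bigcap_(i in [set` J]) (X i @^-1` A i)) =
  (\prod_(i in J) P (X i @^-1` A i))%E.

Definition sum_largest (R : realType) (h k : nat) (x : 'I_k -> R) : R :=
  \sum_(v <- take h (sort >=%R [seq x i | i <- enum 'I_k])) v.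

Definition g_h (d : measure_display) (T : measurableType d)
    (R : realType) (P : probability T R) (h k : nat)
    (X : 'I_k -> {RV P >-> R}) : \bar R :=
  'E_P[fun w => sum_largest h (fun i => X i w)].

(* The n-fold power of a probability space, as an iterated binary product
   with the one-point space as 0-th power. *)
Fixpoint pow_display (d : measure_display) (n : nat) : measure_display :=
  if n is m.+1 then ((d, pow_display d m).-prod)%mdisp
  else default_measure_display.

Fixpoint pow_space (d : measure_display) (T : measurableType d) (n : nat) :
    measurableType (pow_display d n) :=
  match n return measurableType (pow_display d n) with
  | 0 => unit
  | m.+1 => (T * pow_space T m)%type
  end.

Fixpoint pow_prob (d : measure_display) (T : measurableType d)
    (R : realType) (P : probability T R) (n : nat) :
    probability (pow_space T n) R :=
  match n return probability (pow_space T n) R with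
  | 0 => \d_(tt : unit)
  | m.+1 => (P \x pow_prob P m)%E
  end.

(* copy_fun X w i is X evaluated at the i-th coordinate of w. *)
Fixpoint copy_fun (d : measure_display) (T : measurableType d)
    (R : realType) (X : T -> R) (n : nat) : pow_space T n -> 'I_n -> R :=
  match n return pow_space T n -> 'I_n -> R with
  | 0 => fun _ _ => 0
  | m.+1 => fun w i =>
      if unlift ord0 i is Some j then copy_fun X w.2 j else X w.1
  end.

Section independent_copies.
Context (d : measure_display) (T : measurableType d) (R : realType)
  (P : probability T R) (X : {RV P >-> R}).

Lemma measurable_copy_fun (n : nat) (i : 'I_n) :
  measurable_fun [set: pow_space T n] (fun w => copy_fun X w i).
Proof.
elim: n i => [[]//|n IH] i /=.
case: unliftP => [j _|_].
  exact: (measurableT_comp (IH j) measurable_snd).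
exact: (measurableT_comp (@measurable_funPT _ _ _ _ X) measurable_fst).
Qed.

Definition copy_at (n : nat) (i : 'I_n) (w : pow_space T n) : R :=
  copy_fun X w i.

HB.instance Definition _ (n : nat) (i : 'I_n) :=
  isMeasurableFun.Build _ _ _ _ (@copy_at n i) (@measurable_copy_fun n i).

Definition copy (n : nat) (i : 'I_n) : {RV (pow_prob P n) >-> R} :=
  @copy_at n i.

Lemma pow_prob_box (n : nat) (A : 'I_n -> set R) :
  (forall i, measurable (A i)) ->
  pow_prob P n [set w | forall i, A i (copy i w)] =
  (\prod_(i < n) P (X @^-1` A i))%E.
Proof.
elim: n A => [|n IH] A mA.
  rewrite big_ord0 (_ : [set _ | _] = setT) ?probability_setT//.
  by apply/seteqP; split => // w _ [].
rewrite big_ord_recl -IH//.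
rewrite -product_measure1E.
- congr (_ _); apply/seteqP; split => -[w1 w2] /=.
    move=> H; split.
      by move: (H ord0); rewrite /copy/= /copy_at/= unlift_none.
    by move=> i; move: (H (lift ord0 i)); rewrite /copy/= /copy_at/= liftK.
  move=> [H1 H2] i; rewrite /copy/= /copy_at/=.
  by case: unliftP => [j ->|->//]; exact: H2.
- exact: measurable_funPTI.
- rewrite (_ : [set _ | _] =
      \bigcap_(i in [set: 'I_n]) (copy i @^-1` A (lift ord0 i))).
    apply: fin_bigcap_measurable; first exact: finite_finset.
    by move=> i _; exact: measurable_funPTI.
  by apply/seteqP; split => w /= H i //=; exact: H.
Qed.

Lemma copy_distribution (n : nat) (i : 'I_n) (A : set R) : measurable A ->
  distribution (pow_prob P n) (copy i) A = distribution P X A.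
Proof.
move=> mA.
have := @pow_prob_box n (fun j => if j == i then A else setT).
rewrite (bigD1 i)//= eqxx big1 => [|j /negbTE ->]; last first.
  by rewrite preimage_setT probability_setT.
rewrite /distribution /pushforward mule1 => <-; last by move=> j; case: ifP.
congr (_ _); apply/seteqP; split => w /=.
  by move=> H j; case: eqP => // ->.
by move=> /(_ i); rewrite eqxx.
Qed.

Lemma copy_independent (n : nat) : mutually_independent (@copy n).
Proof.
move=> J A mA.
rewrite (eq_bigr (fun i => P (X @^-1` A i))); last first.
  by move=> i _; exact: copy_distribution.
have := @pow_prob_box n (fun j => if j \in J then A j else setT).
rewrite (bigID (mem J))/= [X in (_ * X)%E]big1 => [|i /negbTE ->]; last first.
  by rewrite preimage_setT probability_setT.
rewrite mule1 (eq_bigr (fun i => P (X @^-1` A i))) => [<-|i ->//]; last first.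
  by move=> j; case: ifP.
congr (_ _); apply/seteqP; split => w /= H i.
  by case: ifPn => // iJ; exact: H.
by move=> /= iJ; have := H i; rewrite iJ.
Qed.

End independent_copies.

(* The neutral element 0 of the maximum is harmless: candidates are
   nonnegative and f_h is only used with 0 < h <= k, where k %/ h > 0. *)
Definition f_h (d : measure_display) (T : measurableType d)
    (R : realType) (P : probability T R) (h k : nat) (X : {RV P >-> R}) :
    \bar R :=
  'E_(pow_prob P (k %/ h))
    [fun w => \big[Num.max/0]_(j < k %/ h) copy X j w].

Section max_expectation.
Context (d : measure_display) (T : measurableType d) (R : realType)
  (P : probability T R) (n : nat) (Y : 'I_n -> {RV P >-> R}).

Let maxY (w : T) : R := \big[Num.max/0]_(j < n) Y j w.

Let measurable_maxY : measurable_fun setT maxY.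
Proof.
rewrite /maxY; elim: (index_enum _) => [|j s IH].
  by under eq_fun do rewrite big_nil; exact: measurable_cst.
under eq_fun do rewrite big_cons.
exact: measurable_realfun.measurable_maxr.
Qed.

HB.instance Definition _ := isMeasurableFun.Build _ _ _ _ maxY measurable_maxY.

Lemma expectation_max : mutually_independent Y ->
  ('E_P[fun w => (\big[Num.max/0]_(j < n) Y j w)%R] =
  \int[lebesgue_measure]_(r in `[0%R, +oo[) (1 - \prod_(j < n) cdf (Y j) r))%E.
Proof.
move=> indY.
have maxY_ge0 w : 0 <= maxY w by exact: bigmax_ge_id.
rewrite (@ge0_expectation_ccdf _ _ _ _ (maxY : {RV P >-> R}) maxY_ge0).
apply: eq_integral => r; rewrite inE/= in_itv/= andbT => r0.
rewrite ccdf_1_cdf; congr (1 - _)%E.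
transitivity (\prod_(j in [set: 'I_n]%SET) P (Y j @^-1` `]-oo, r]))%E;
    last first.
  by apply: eq_bigl => j; rewrite inE.
rewrite -(indY _ (fun=> `]-oo, r]%classic))//.
rewrite /cdf /distribution /pushforward; congr (P _).
apply/seteqP; split => w /=; rewrite /maxY in_itv/=.
  by move=> /bigmax_leP[_ H] j _ /=; rewrite in_itv/=; exact: H.
move=> H; apply/bigmax_leP; split => // j _.
by have := H j; rewrite /= inE in_itv/=; exact.
Qed.

End max_expectation.

(* f_h does not depend on the choice of the independent copies. *)
Lemma f_h_copiesE (d d' : measure_display) (T : measurableType d)
    (T' : measurableType d') (R : realType) (P : probability T R)
    (P' : probability T' R) (h k : nat) (X : {RV P >-> R})
    (Y : 'I_(k %/ h) -> {RV P' >-> R}) :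
  mutually_independent Y ->
  (forall j A, measurable A -> distribution P' (Y j) A = distribution P X A) ->
  f_h h k X = ('E_P'[fun w => (\big[Num.max/0]_(j < k %/ h) Y j w)%R])%E.
Proof.
move=> indY distY; rewrite /f_h !expectation_max//; last exact: copy_independent.
apply: eq_integral => r _; congr (1 - _)%E; apply: eq_bigr => j _.
by rewrite /cdf distY// copy_distribution.
Qed.

(* Main.v *)
(** Split the k = h m indices into h blocks of size m. The sum of the h largest
    values is at least the sum of the h block maxima. For one block with
    distribution functions F_1, ..., F_m, the AM-GM inequality gives
    F_1 ... F_m <= (F_1^m + ... + F_m^m) / m; integrating 1 minus both sides
    shows that the expected block maximum is at least the average of the
    f_h (X_i), hence at least c. This yields the stronger bound g_h >= h c,
    and 2 (1 - e^{-1/2})^2 <= 1. *)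

Require Import Defs.
From HB Require Import structures.
From mathcomp Require Import all_boot all_order all_algebra.
From mathcomp Require Import all_classical all_reals all_analysis.
From mathcomp Require Import measurable_realfun lra.

Import Order.TTheory GRing.Theory Num.Theory.
Import numFieldNormedType.Exports.

Local Open Scope classical_set_scope.
Local Open Scope ring_scope.

(** AM-GM applied to the powers [a i ^+ m], after raising both sides to the power [m]; for [m = 0]
    both sides vanish. *)
Lemma natr_prod_le_sum_exp (R : realFieldType) (m : nat) (a : 'I_m -> R) :
  (forall i, 0 <= a i) ->
  m%:R * (\prod_(i < m) a i) <= \sum_(i < m) a i ^+ m.
Proof.
case: m a => [|m] a a0; first by rewrite mul0r big_ord0.
rewrite mulrC -ler_pdivlMr ?ltr0n//.
rewrite -(@ler_pXn2r _ m.+1)//; last 2 first.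
- by rewrite nnegrE prodr_ge0.
- by rewrite nnegrE divr_ge0// sumr_ge0// => i _; rewrite exprn_ge0.
rewrite -prodrXl.
have am0 : {in predT, forall i, 0 <= a i ^+ m.+1}.
  by move=> i _; exact: exprn_ge0.
by have [+ _] := leif_AGM am0; rewrite card_ord.
Qed.

(* Unlike ge0_le_integral, no measurability is needed: both sides are suprema
   over the simple functions below the integrand. *)
Lemma ge0_le_integralT (d : measure_display) (T : measurableType d)
    (R : realType) (mu : {measure set T -> \bar R}) (f g : T -> \bar R) :
  (forall x, 0 <= f x)%E -> (forall x, f x <= g x)%E ->
  (\int[mu]_x f x <= \int[mu]_x g x)%E.
Proof.
move=> f0 fg.
rewrite !ge0_integralTE//; last by move=> x; exact: le_trans (fg x).
apply: ereal_sup_le => _ [u uf <-]; exists u => // x.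
exact: le_trans (uf x) (fg x).
Qed.

(** Each of the [h] largest values is [v] plus its excess over [v], and the other values have no
    excess. This trades the sorted list for a sum over all indices, which can be regrouped into
    blocks. *)
Lemma sum_largest_threshold (R : realType) (h k : nat) (x : 'I_k -> R) :
  (forall i, 0 <= x i) -> (h <= k)%N ->
  exists2 v, 0 <= v &
    sum_largest h x = h%:R * v + \sum_(i < k) Num.max (x i - v) 0.
Proof.
move=> x0 hk; rewrite /sum_largest.
set s := sort _ _.
have sz : size s = k by rewrite size_sort size_map size_enum_ord.
have s_ge0 y : y \in s -> 0 <= y.
  by rewrite mem_sort => /mapP[i _ ->].
have s_sorted i j : (i <= j)%N -> (j < k)%N -> s`_j <= s`_i.
  move=> ij jk.
  have ss : sorted >=%R s by apply: sort_sorted => a b; exact: le_total.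
  apply: (sorted_leq_nth _ _ 0 ss) => //.
  - by move=> b a c /= ab bc; exact: le_trans bc ab.
  - by move=> a /=.
  - by rewrite unfold_in /= sz (leq_ltn_trans ij).
  - by rewrite unfold_in /= sz.
(* The threshold is the h-th largest value. *)
exists s`_h.-1.
  (* For [h = 0] the index [h.-1] is 0, so [v] is the maximum and every excess is zero. The list is
     too short only when [k = 0], and then [v] is the default 0. *)
  have [hk'|hk'] := ltnP h.-1 k; last by rewrite nth_default// sz.
  by apply: s_ge0; rewrite mem_nth// sz.
set v := s`_h.-1.
have -> : \sum_(i < k) Num.max (x i - v) 0 =
    \sum_(y <- take h s) Num.max (y - v) 0 +
    \sum_(y <- drop h s) Num.max (y - v) 0.
  rewrite -big_cat cat_take_drop.
  by rewrite (perm_big _ (permEl (perm_sort _ _))) big_map enumT.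
(* Entries from position [h] on are at most [v], so their truncated excess is 0; the earlier ones
   are at least [v], so truncation does nothing. *)
rewrite [X in _ + (_ + X)]big1_seq ?addr0; last first.
  move=> y /andP[_ /(nthP 0)[i]]; rewrite size_drop sz nth_drop => ik <-.
  apply/max_idPr; rewrite subr_le0 s_sorted//.
    by rewrite (leq_trans (leq_pred h))// leq_addr.
  by rewrite -ltn_subRL.
rewrite [X in _ = _ + X](eq_big_seq (fun y => y - v)); last first.
  move=> y /(nthP 0)[i]; rewrite size_take_min sz (minn_idPl hk) => ih <-.
  rewrite nth_take//; apply/max_idPl; rewrite subr_ge0 s_sorted//.
    by rewrite -ltnS (ltn_predK ih).
  by rewrite prednK ?(leq_ltn_trans _ ih).
rewrite big_split /= sumrN big_const_seq count_predT size_take_min sz.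
rewrite (minn_idPl hk) iter_addr_0 mulr_natl.
by rewrite [RHS]addrC subrK.
Qed.

(** With [v] the threshold for [h], a block maximum is at most [v] plus the sum of the excesses in
    its block. Over the [h] blocks, these bounds add up to [sum_largest h x]. *)
Lemma sum_block_max_le (R : realType) (h m : nat) (x : 'I_(h * m) -> R) :
  (0 < m)%N -> (forall i, 0 <= x i) ->
  \sum_(b < h) \big[Num.max/0]_(j < m) x (mxvec_index b j) <= sum_largest h x.
Proof.
move=> m0 x0.
have [|v v0 ->] := @sum_largest_threshold R h _ x x0.
  exact: leq_pmulr.
have -> : \sum_(i < h * m) Num.max (x i - v) 0 =
    \sum_(b < h) \sum_(j < m) Num.max (x (mxvec_index b j) - v) 0.
  rewrite pair_big (reindex _ (curry_mxvec_bij h m)) /=.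
  by apply: eq_bigr => -[].
have -> : h%:R * v = \sum_(b < h) v by rewrite sumr_const card_ord mulr_natl.
rewrite -big_split /=; apply: ler_sum => b _.
have pos j : 0 <= Num.max (x (mxvec_index b j) - v) 0.
  by rewrite le_max lexx orbT.
apply/bigmax_leP; split=> [|j _]; first by rewrite addr_ge0// sumr_ge0.
rewrite (bigD1 j)//= -lerBlDl.
apply: (@le_trans _ _ (Num.max (x (mxvec_index b j) - v) 0)).
  by rewrite le_max lexx.
by rewrite lerDl sumr_ge0.
Qed.

Lemma mutually_independent_inj (d : measure_display) (T : measurableType d)
    (R : realType) (P : probability T R) (I J : finType)
    (X : I -> {RV P >-> R}) (phi : J -> I) :
  injective phi -> mutually_independent X ->
  mutually_independent (fun j => X (phi j)).
Proof.
move=> phi_inj indX K A mA.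
(* The family [A] is transported along [phi]; injectivity makes the picked preimage unique, and
   indices outside the image get the whole space. *)
pose B i := if [pick j | phi j == i] is Some j then A j else setT.
have BE j : B (phi j) = A j.
  rewrite /B; case: pickP => [j' /eqP/phi_inj->//|/(_ j)].
  by rewrite eqxx.
have mB i : measurable (B i) by rewrite /B; case: pickP.
have := indX (phi @: K)%SET B mB.
rewrite big_imset /=; last by move=> ? ? _ _; exact: phi_inj.
under eq_bigr do rewrite BE.
move=> <-; congr (P _); apply/seteqP; split=> w /= H.
  move=> _ /= /imsetP[j jK ->]; rewrite BE; exact: H.
move=> j jK; rewrite -BE; apply: H => /=; exact: imset_f.
Qed.

Lemma measurable_bigmaxr (d : measure_display) (T : measurableType d)
    (R : realType) (n : nat) (Y : 'I_n -> T -> R) :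
  (forall j, measurable_fun setT (Y j)) ->
  measurable_fun setT (fun w => \big[Num.max/0]_(j < n) Y j w).
Proof.
move=> mY; elim: (index_enum _) => [|j s IH].
  by under eq_fun do rewrite big_nil; exact: measurable_cst.
under eq_fun do rewrite big_cons.
exact: measurable_maxr.
Qed.

Section cdf_product.
Context (d : measure_display) (T : measurableType d) (R : realType)
  (P : probability T R) (n : nat) (Y : 'I_n -> {RV P >-> R}).

Lemma prod_cdf_fineE (r : R) :
  (\prod_(j < n) cdf (Y j) r = (\prod_(j < n) fine (cdf (Y j) r))%:E)%E.
Proof.
rewrite -prodEFin; apply: eq_bigr => j _; rewrite fineK//.
exact: fin_num_measure.
Qed.

Lemma measurable_onem_prod_cdf (D : set R) :
  measurable_fun D (fun r => 1 - \prod_(j < n) cdf (Y j) r)%E.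
Proof.
apply: (@measurable_funS _ _ _ _ setT) => //.
under eq_fun do rewrite prod_cdf_fineE -EFinB.
apply/measurable_EFinP; apply: measurable_funB => //.
apply: measurable_prod => j _.
exact: measurableT_comp (cdf_measurable (Y j)).
Qed.

Lemma fine_cdf_itv01 (j : 'I_n) (r : R) : 0 <= fine (cdf (Y j) r) <= 1.
Proof.
rewrite fine_ge0 ?cdf_ge0//= -lee_fin fineK ?cdf_le1//.
exact: fin_num_measure.
Qed.

Lemma onem_prod_cdf_ge0 (r : R) : (0 <= 1 - \prod_(j < n) cdf (Y j) r)%E.
Proof.
rewrite prod_cdf_fineE -EFinB lee_fin subr_ge0.
by apply: prodr_ile1 => j _; exact: fine_cdf_itv01.
Qed.

End cdf_product.

(** Both sides become integrals over [r] of expressions in the distribution functions of the [Y j],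
    where AM-GM applies for each [r]. *)
Lemma sum_f_h_le_expectation_max (d : measure_display) (T : measurableType d)
    (R : realType) (P : probability T R) (h m : nat)
    (Y : 'I_m -> {RV P >-> R}) :
  (0 < h)%N -> mutually_independent Y ->
  (\sum_(j < m) f_h h (m * h) (Y j) <=
   m%:R%:E * 'E_P[fun w => (\big[Num.max/0]_(j < m) Y j w)%R])%E.
Proof.
move=> h0 indY.
rewrite expectation_max// -ge0_integralZl//; last 2 first.
- exact: measurable_onem_prod_cdf.
- by move=> r _; exact: onem_prod_cdf_ge0.
under eq_bigr => j _.
  rewrite /f_h mulnK// expectation_max; last exact: copy_independent.
  over.
rewrite -ge0_integral_sum//; last 2 first.
- by move=> j; exact: measurable_onem_prod_cdf.
- by move=> j r _; exact: onem_prod_cdf_ge0.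
apply: ge0_le_integral => //.
- by move=> r _; apply: sume_ge0 => j _; exact: onem_prod_cdf_ge0.
- by apply: emeasurable_sum => j; exact: measurable_onem_prod_cdf.
- by apply: emeasurable_funM => //; exact: measurable_onem_prod_cdf.
move=> r _.
under eq_bigr => j _.
  (* The [m] copies of [Y j] share its distribution function, so the product is a power. *)
  rewrite (_ : \prod_(l < m) _ = (fine (cdf (Y j) r) ^+ m)%:E)%E; last first.
    rewrite prod_cdf_fineE -[in RHS](card_ord m) -prodr_const.
    by congr EFin; apply: eq_bigr => l _; rewrite /cdf copy_distribution.
  rewrite -EFinB; over.
rewrite sumEFin prod_cdf_fineE -EFinB -EFinM lee_fin mulrBr mulr1.
rewrite sumrB sumr_const card_ord lerB// natr_prod_le_sum_exp// => j.
by have /andP[] := @fine_cdf_itv01 _ _ _ _ _ Y j r.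
Qed.

Theorem theorem2p15 (d : measure_display) (T : measurableType d)
    (R : realType) (P : probability T R) (k h : nat) (c : R)
    (X : 'I_k -> {RV P >-> R}) :
  (1 <= k)%N -> (1 <= h <= k)%N -> (h %| k)%N -> 0 <= c ->
  (forall i, candidate (X i)) ->
  mutually_independent X ->
  (forall i, c%:E <= f_h h k (X i))%E ->
  ((2 * h%:R * c * (1 - expR (- (1 / 2))) ^+ 2)%:E <= g_h h X)%E.
Proof.
move=> k0 /andP[h0 hk] /dvdnP[m km] c0 candX indX fX.
have X0 i w : 0 <= X i w := (candX i).1 w.
have m0 : (0 < m)%N by move: k0; rewrite km muln_gt0 => /andP[].
(* With [k] written as [h * m], [mxvec_index b j] is the [j]-th index of block [b]. *)
rewrite mulnC in km; subst k.
pose M b w := \big[Num.max/0]_(j < m) X (mxvec_index b j) w.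
have EM (b : 'I_h) : (c%:E <= 'E_P[M b])%E.
  have inj_b : injective (@mxvec_index h m b).
    by move=> j j' /cast_ord_inj/enum_rank_inj[].
  have := @sum_f_h_le_expectation_max _ _ _ P h m _ h0
    (mutually_independent_inj _ _ _ _ _ _ _ _ inj_b indX).
  (* Multiplied by [m], the claim compares [m] copies of [c] with the sum of the [f_h] over the
     block. *)
  rewrite -/(M b) => H; rewrite -(@lee_pmul2l _ m%:R%:E) ?lte_fin ?ltr0n//.
  apply: le_trans H; rewrite -EFinM mulr_natl.
  have -> : c *+ m = \sum_(j < m) c by rewrite sumr_const card_ord.
  by rewrite -sumEFin; apply: lee_sum => j _; rewrite mulnC.
apply: (@le_trans _ _ (\sum_(b < h) 'E_P[M b])%E).
  apply: (@le_trans _ _ (\sum_(b < h) c%:E)%E); last exact: lee_sum.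
  rewrite sumEFin sumr_const card_ord lee_fin -[c *+ h]mulr_natl.
  rewrite -[2 * _ * c]mulrA mulrAC ler_piMl ?mulr_ge0//.
  (* These bounds place [1 - expR (- (1 / 2))] between 0 and 1/2, so twice its square is at most
     1/2, hence at most 1. *)
  have e_ge : 1 + - (1 / 2) <= expR (- (1 / 2)) :> R by exact: expR_ge1Dx.
  have e_le : expR (- (1 / 2)) <= 1 :> R by rewrite expR_le1; lra.
  by nra.
rewrite /g_h expectation.unlock.
rewrite -(ge0_integral_sum P measurableT (f := fun b w => (M b w)%:E));
    last 2 first.
- move=> b; apply/measurable_EFinP; apply: measurable_bigmaxr => j.
  exact: measurable_funPT.
- by move=> b w _; rewrite lee_fin; exact: bigmax_ge_id.
(* What remains is a comparison at each [w]; this form of monotonicity spares a measurability proof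
   for [sum_largest]. *)
apply: ge0_le_integralT => w.
  by apply: sume_ge0 => b _; rewrite lee_fin; exact: bigmax_ge_id.
by rewrite sumEFin lee_fin; exact: sum_block_max_le.
Qed.
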